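(* Suppose that $\mathrm{SBM}(p,Q)$ is a stochastic block model such that $Q$ is diagonal. Then, for any connected graph $H$ with at least one edge, $$\Psi_{\mathrm{SBM}(p,Q)}(H)\le\max\big(\Psi_{\mathrm{SBM}(p,Q)}(\mathrm{Star}_1),\Psi_{\mathrm{SBM}(p,Q)}(\mathrm{Star}_2)\big).$$
   Context: Graphs are finite, simple and undirected. $\mathrm{Star}_1$ is a single edge and $\mathrm{Star}_2$ the path with two edges. A stochastic block model on $k$ communities is given by a probability vector $p=(p_1,\dots,p_k)\in(0,1]^k$ and a symmetric matrix $Q\in[-1,1]^{k\times k}$. A sample $\mathbf{G}\sim\mathrm{SBM}(n;p,Q)$ is an $n$-vertex graph produced by drawing i.i.d. labels $\mathbf{x}_1,\dots,\mathbf{x}_n\in[k]$ with pmf $p$, and then including each edge $(i,j)$ independently with probability $(1+Q_{\mathbf{x}_i,\mathbf{x}_j})/2$. For a graph $H$ (placed on any $|V(H)|$ of the vertices, $n\ge|V(H)|$), the Fourier coefficient is $\Phi_{\mathrm{SBM}(p,Q)}(H)=\mathbb{E}_{\mathbf{G}\sim\mathrm{SBM}(n;p,Q)}\big[\prod_{(i,j)\in E(H)}(2\mathbf{G}_{ij}-1)\big]$ (independent of $n$ and of the placement), and $\Psi_{\mathrm{SBM}(p,Q)}(H)=|\Phi_{\mathrm{SBM}(p,Q)}(H)|^{1/|V(H)|}$. *)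

(* Defs.v *)
From HB Require Import structures.
From mathcomp Require Import all_boot all_order all_algebra.
From mathcomp Require Import reals exp.
From mathcomp Require Import ring.

Set Implicit Arguments.
Unset Strict Implicit.
Unset Printing Implicit Defensive.

Import Order.TTheory GRing.Theory Num.Theory.
Local Open Scope ring_scope.

Definition simple_adj n (A : 'M[bool]_n) : bool :=
  (A^T == A) && [forall i, ~~ A i i].

Record sgraph (n : nat) := SGraph {
  adj :> 'M[bool]_n;
  adj_simple : simple_adj adj
}.

HB.instance Definition _ n := [isSub for @adj n].
HB.instance Definition _ n := [Finite of sgraph n by <:].

Definition connected_graph n (G : sgraph n) : Prop :=
  forall i j : 'I_n, connect (fun u v => G u v) i j.

Definition has_edge n (G : sgraph n) : Prop := exists i j : 'I_n, G i j.

Definition star_adj t : 'M[bool]_t.+1 :=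
  \matrix_(i, j) ((i != j) && ((i == ord0) || (j == ord0))).

Lemma star_simple t : simple_adj (star_adj t).
Proof.
apply/andP; split; last by apply/forallP => i; rewrite mxE eqxx.
by apply/eqP/matrixP => i j; rewrite !mxE eq_sym orbC.
Qed.

(* The star with center [ord0] and [t] leaves; [star 1] is a single edge and
   [star 2] is the path with two edges. *)
Definition star t : sgraph t.+1 := SGraph (star_simple t).

Definition is_sbm (R : realType) k (p : 'I_k -> R) (Q : 'M[R]_k) : Prop :=
  [/\ forall a, 0 < p a <= 1,
      \sum_a p a = 1,
      Q^T = Q &
      forall a b, -1 <= Q a b <= 1].

(* Each unordered pair of vertices is represented by its ordered version
   [e.1 < e.2]. *)
Definition sbm_pmf_given (R : realType) k (Q : 'M[R]_k) n
    (x : {ffun 'I_n -> 'I_k}) (G : sgraph n) : R :=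
  \prod_(e : 'I_n * 'I_n | (e.1 < e.2)%N)
    (if G e.1 e.2 then (1 + Q (x e.1) (x e.2)) / 2
     else 1 - (1 + Q (x e.1) (x e.2)) / 2).

Definition sbm_pmf (R : realType) k (p : 'I_k -> R) (Q : 'M[R]_k) n
    (G : sgraph n) : R :=
  \sum_(x : {ffun 'I_n -> 'I_k}) (\prod_i p (x i)) * sbm_pmf_given Q x G.

Definition sbm_expectation (R : realType) k (p : 'I_k -> R) (Q : 'M[R]_k) n
    (X : sgraph n -> R) : R :=
  \sum_(G : sgraph n) sbm_pmf p Q G * X G.

(* The Fourier coefficient of [H] placed on the vertices [f 0, f 1, ...] of an
   [n]-vertex sample; meaningful for injective [f]. *)
Definition Phi_at (R : realType) k (p : 'I_k -> R) (Q : 'M[R]_k) n m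
    (f : 'I_m -> 'I_n) (H : sgraph m) : R :=
  sbm_expectation p Q (fun G : sgraph n =>
    \prod_(e : 'I_m * 'I_m | (e.1 < e.2)%N && H e.1 e.2)
      (2 * (G (f e.1) (f e.2))%:R - 1)).

(* The sample has exactly [m] vertices and [H] is placed identically on them;
   [Phi_at_indep] shows that this choice is immaterial. *)
Definition Phi (R : realType) k (p : 'I_k -> R) (Q : 'M[R]_k) m
    (H : sgraph m) : R := Phi_at p Q id H.

Definition Psi (R : realType) k (p : 'I_k -> R) (Q : 'M[R]_k) m
    (H : sgraph m) : R := `|Phi p Q H| `^ (m%:R^-1).

Lemma sgraph_sym n (G : sgraph n) i j : G i j = G j i.
Proof. by case: G => A /= /andP[/eqP AT _]; rewrite -[in LHS]AT mxE. Qed.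

Lemma sgraph_irr n (G : sgraph n) i : G i i = false.
Proof. by case: G => A /= /andP[_ /forallP/(_ i)/negbTE]. Qed.

Lemma sum_sgraph_prod (R : realType) n (F : 'I_n * 'I_n -> bool -> R) :
  \sum_(G : sgraph n) \prod_(e : 'I_n * 'I_n | (e.1 < e.2)%N) F e (G e.1 e.2)
  = \prod_(e : 'I_n * 'I_n | (e.1 < e.2)%N) (F e true + F e false).
Proof.
pose P : pred ('I_n * 'I_n) := fun e => (e.1 < e.2)%N.
pose A (f : {ffun 'I_n * 'I_n -> bool}) : 'M[bool]_n :=
  \matrix_(i, j) ((i < j)%N && f (i, j) || (j < i)%N && f (j, i)).
have As f : simple_adj (A f).
  apply/andP; split; last by apply/forallP => i; rewrite mxE ltnn.
  by apply/eqP/matrixP => i j; rewrite !mxE orbC.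
pose g f := SGraph (As f).
pose h (G : sgraph n) : {ffun 'I_n * 'I_n -> bool} :=
  [ffun e : 'I_n * 'I_n => (e.1 < e.2)%N && G e.1 e.2].
have gh : cancel h g.
  move=> G; apply/val_inj/matrixP => i j /=; rewrite !mxE !ffunE /=.
  rewrite (sgraph_sym G j i) !andbA !andbb.
  case: ltngtP => /= [_|_|/val_inj ->]; rewrite ?orbF //.
  by rewrite sgraph_irr.
transitivity (\sum_(f in pffun_on false P predT) \prod_(e | P e) F e (f e)).
  rewrite (reindex_onto g h) /=; last by move=> G _; rewrite gh.
  apply: eq_big => [f|f _]; last first.
    apply: eq_bigr => -[i j] /= ij; rewrite mxE ij (ltnNge j) (ltnW ij) /=.
    by rewrite orbF.
  apply/eqP/pfamilyP => [<-|[fP _]].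
    split=> //; apply/subsetP => e; rewrite inE ffunE.
    by rewrite -topredE /= /P; case: ltnP.
  apply/ffunP => -[i j]; rewrite ffunE /= mxE.
  case: ltngtP => //= [ij|ij|ij]; first by rewrite orbF.
  - apply/esym/negbTE; apply/negP => fij.
    have /(subsetP fP) : (i, j) \in false.-support f by rewrite inE fij.
    by rewrite -topredE /P /= ltnNge (ltnW ij).
  - apply/esym/negbTE; apply/negP => fij.
    have /(subsetP fP) : (i, j) \in false.-support f by rewrite inE fij.
    by rewrite -topredE /P /= ij ltnn.
rewrite -big_distr_big; apply: eq_bigr => e _.
by rewrite big_bool.
Qed.

Lemma sum_labels_comp (R : realType) k (p : 'I_k -> R) n m (f : 'I_m -> 'I_n)
    (K : {ffun 'I_m -> 'I_k} -> R) :
  \sum_a p a = 1 -> injective f ->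
  \sum_(x : {ffun 'I_n -> 'I_k}) (\prod_i p (x i)) * K [ffun i => x (f i)]
  = \sum_(y : {ffun 'I_m -> 'I_k}) (\prod_i p (y i)) * K y.
Proof.
move=> p1 finj.
rewrite (partition_big (fun x : {ffun 'I_n -> 'I_k} => [ffun i => x (f i)])
  predT) //=; apply: eq_bigr => y _.
transitivity ((\sum_(x : {ffun 'I_n -> 'I_k} | [ffun i => x (f i)] == y)
   \prod_i p (x i)) * K y).
  by rewrite mulr_suml; apply: eq_bigr => x /eqP ->.
congr (_ * _).
pose q v a := [forall i, (f i == v) ==> (a == y i)].
transitivity (\prod_v \sum_(a | q v a) p a).
  rewrite bigA_distr_big_dep; apply: eq_bigl => x.
  apply/eqP/familyP => [xy v|xq].
    by apply/forallP => i; apply/implyP => /eqP <-; rewrite -xy ffunE.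
  apply/ffunP => i; rewrite ffunE.
  by have /forallP/(_ i) := xq (f i); rewrite eqxx => /eqP.
rewrite (bigID (fun v => v \in codom f)) /= [X in _ * X]big1 ?mulr1.
  rewrite (eq_bigl (fun v => v \in f @: setT)); last first.
    move=> v; apply/codomP/imsetP => [[i ->]|[i _ ->]]; last by exists i.
    by exists i.
  rewrite big_imset /=; last by move=> i j _ _; apply: finj.
  rewrite (eq_bigl predT) => [|i]; last by rewrite inE.
  apply: eq_bigr => i _; rewrite (big_pred1 (y i)) // => a.
  apply/forallP/eqP => [/(_ i)|-> j]; first by rewrite eqxx => /eqP.
  by apply/implyP => /eqP/finj ->.
move=> v vf; rewrite -[RHS]p1; apply: eq_bigl => a.
apply/forallP => i; apply/implyP => /eqP fi.
by move: vf; rewrite -fi codom_f.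
Qed.

Lemma Phi_atE (R : realType) k (p : 'I_k -> R) (Q : 'M[R]_k) n m
    (f : 'I_m -> 'I_n) (H : sgraph m) :
  is_sbm p Q -> injective f ->
  Phi_at p Q f H =
  \sum_(y : {ffun 'I_m -> 'I_k}) (\prod_i p (y i)) *
    \prod_(e : 'I_m * 'I_m | (e.1 < e.2)%N && H e.1 e.2) Q (y e.1) (y e.2).
Proof.
move=> [_ p1 QT _] finj; rewrite -(sum_labels_comp _ p1 finj).
have Qs a b : Q a b = Q b a by rewrite -[in LHS]QT mxE.
rewrite /Phi_at /sbm_expectation.
under eq_bigr do rewrite mulr_suml.
rewrite exchange_big /=; apply: eq_bigr => x _.
under eq_bigr do rewrite -mulrA.
rewrite -mulr_sumr; congr (_ * _).
pose o (e : 'I_m * 'I_m) : 'I_n * 'I_n :=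
  if (f e.1 < f e.2)%N then (f e.1, f e.2) else (f e.2, f e.1).
pose E := [set e : 'I_m * 'I_m | (e.1 < e.2)%N && H e.1 e.2].
have oinj : {in E &, injective o}.
  move=> [a b] [c d]; rewrite !inE /o /= => /andP[ab _] /andP[cd _].
  case: ifP => _; case: ifP => _ [] /finj e1 /finj e2; subst=> //.
  - by move: (ltn_trans ab cd); rewrite ltnn.
  - by move: (ltn_trans ab cd); rewrite ltnn.
have olt e : e \in E -> ((o e).1 < (o e).2)%N.
  case: e => a b; rewrite inE /o /= => /andP[ab _].
  case: (ltngtP (f a) (f b)) => //= /ord_inj/finj abE.
  by rewrite abE ltnn in ab.
have prodE (S : 'I_n -> 'I_n -> R) : (forall i j, S i j = S j i) ->
    \prod_(e : 'I_m * 'I_m | (e.1 < e.2)%N && H e.1 e.2) S (f e.1) (f e.2)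
    = \prod_(e : 'I_n * 'I_n | (e.1 < e.2)%N)
        (if e \in o @: E then S e.1 e.2 else 1).
  move=> Ssym; rewrite -big_mkcondr /=.
  rewrite (eq_bigl (fun e => e \in o @: E)); last first.
    move=> e; rewrite andbC; case: imsetP => //= -[e' e'E ->].
    by rewrite olt.
  rewrite big_imset //=; apply: eq_big => [e|e _]; first by rewrite inE.
  by rewrite /o; case: ifP => //= _; rewrite Ssym.
under [RHS]eq_bigr do rewrite !ffunE.
rewrite (prodE (fun i j => Q (x i) (x j))) //.
pose F (e : 'I_n * 'I_n) (b : bool) : R :=
  (if b then (1 + Q (x e.1) (x e.2)) / 2
   else 1 - (1 + Q (x e.1) (x e.2)) / 2) *
  (if e \in o @: E then 2 * b%:R - 1 else 1).
rewrite (eq_bigr (fun G : sgraph n =>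
  \prod_(e : 'I_n * 'I_n | (e.1 < e.2)%N) F e (G e.1 e.2))); last first.
  move=> G _; rewrite (prodE (fun i j => 2 * (G i j)%:R - 1)); last first.
    by move=> i j; rewrite sgraph_sym.
  by rewrite -big_split.
rewrite sum_sgraph_prod; apply: eq_bigr => e _; rewrite /F.
by case: ifP => _ /=; field.
Qed.

Lemma Phi_at_indep (R : realType) k (p : 'I_k -> R) (Q : 'M[R]_k) n m
    (f : 'I_m -> 'I_n) (H : sgraph m) :
  is_sbm p Q -> injective f -> Phi_at p Q f H = Phi p Q H.
Proof. by move=> sbm finj; rewrite /Phi !Phi_atE. Qed.

(* Main.v *)
(** For diagonal [Q] and connected [H] with [m] vertices and [e] edges only
    constant labellings contribute, so [Phi H = \sum_a p_a^m Q_aa^e], and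
    [e >= m - 1].  If [m = 2] then [H] is [star 1].  If [m >= 3], put
    [s = Psi (star 2)], so that [s^3 = \sum_a p_a^3 Q_aa^2]; every [p_a |Q_aa|]
    is at most [s], hence
    [|Phi H| <= \sum_a p_a^3 Q_aa^2 (p_a |Q_aa|)^(m-3) <= s^3 s^(m-3) = s^m]. *)

Require Import Defs.
From mathcomp Require Import all_boot all_order all_algebra.
From mathcomp Require Import reals.
From mathcomp Require Import exp.

Import Order.TTheory GRing.Theory Num.Theory.
Local Open Scope ring_scope.

(** Each edge is counted once, as its increasing pair, which matches the index set of the product in
    [Phi_atE]. *)
Definition edges {n} (G : sgraph n) : {set 'I_n * 'I_n} :=
  [set e : 'I_n * 'I_n | (e.1 < e.2)%N && G e.1 e.2].

(** Along a path from [u] to [v], the first step that leaves [S] is such an edge. *)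
Lemma connected_exit n (G : sgraph n) (S : {set 'I_n}) (u v : 'I_n) :
  connected_graph G -> u \in S -> v \notin S ->
  exists x y, [/\ x \in S, y \notin S & G x y].
Proof.
move=> Gc; have /connectP[s] := Gc u v.
elim: s u => [|w s IHs] u /=; first by move=> _ -> ->.
case/andP=> uw ws vE uS vS.
case: (boolP (w \in S)) => wS; first exact: IHs ws vE wS vS.
by exists u, w.
Qed.

(** Growing [S] one vertex at a time along exit edges gains an edge at each step; at [S] the whole
    vertex set this replaces a spanning tree. *)
Lemma connected_grow n (G : sgraph n) (j : nat) :
  connected_graph G -> (j < n)%N ->
  exists S : {set 'I_n},
    #|S| = j.+1 /\
    (j <= #|[set e in edges G | (e.1 \in S) && (e.2 \in S)]|)%N.
Proof.
move=> Gc; elim: j => [|j IHj] jn.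
  by exists [set Ordinal jn]; rewrite cards1.
have [S [cS eS]] := IHj (ltnW jn).
have /card_gt0P[u uS] : (0 < #|S|)%N by rewrite cS.
have [v vS] : exists v, v \notin S.
  apply/existsP; rewrite -negb_forall; apply/negP => /forallP ST.
  have : (#|S| = n)%N by rewrite -[RHS]card_ord; apply: eq_card.
  by move=> cS'; move: jn; rewrite -cS cS' ltnn.
have [x [y [xS yS xy]]] := connected_exit n G S u v Gc uS vS.
exists (y |: S); rewrite cardsU1 yS cS; split=> //.
(* The old edges stay inside the larger set, and the edge between [x] and [y] is new because [y]
   lies outside [S]. *)
apply: leq_ltn_trans eS _; apply: proper_card; apply/properP; split.
  apply/subsetP => e; rewrite !inE => /andP[-> /andP[-> ->]].
  by rewrite !orbT.
have xNy : (x : nat) != y by apply: contraNneq yS => /ord_inj <-.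
exists (if (x < y)%N then (x, y) else (y, x)).
  case: (ltngtP x y) xNy => //= c _;
  by rewrite !inE /= c ?[G y x]sgraph_sym xy xS eqxx orbT.
by rewrite !inE; case: ifP => _; rewrite /= (negbTE yS) ?andbF.
Qed.

Lemma connected_card_edges n (G : sgraph n) :
  connected_graph G -> (n.-1 <= #|edges G|)%N.
Proof.
case: n G => [//|n] G Gc.
have [S [_ /leq_trans]] := connected_grow n.+1 G n Gc (ltnSn n); apply.
by apply: subset_leq_card; apply/subsetP => e; rewrite inE => /andP[].
Qed.

Lemma connected_constant n (G : sgraph n) (T : eqType) (y : 'I_n -> T) :
  connected_graph G -> (forall e, e \in edges G -> y e.1 = y e.2) ->
  forall i j, y i = y j.
Proof.
move=> Gc ye i j; have /connectP[s] := Gc i j.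
elim: s i => [|w s IHs] i /=; first by move=> _ ->.
case/andP=> iw ws jE; rewrite -(IHs w ws jE).
case: (ltngtP i w) => [c|c|/ord_inj ->//].
- by apply: (ye (i, w)); rewrite inE c.
- by apply/esym/(ye (w, i)); rewrite inE c sgraph_sym.
Qed.

(** A nonconstant labelling separates the ends of some edge of the connected graph [H], where the
    factor is an off-diagonal entry of [Q], hence zero. *)
Lemma Phi_diag (R : realType) k (p : 'I_k -> R) (Q : 'M[R]_k) m
    (H : sgraph m.+1) :
  is_sbm p Q -> is_diag_mx Q -> connected_graph H ->
  Phi p Q H = \sum_a p a ^+ m.+1 * Q a a ^+ #|edges H|.
Proof.
move=> sbm /is_diag_mxP Qd Hc; rewrite /Phi Phi_atE //.
rewrite (bigID (fun y : {ffun 'I_m.+1 -> 'I_k} => y == [ffun=> y ord0])) /=.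
rewrite [X in _ + X]big1 ?addr0 => [|y yN].
  (* Constant labellings correspond to their common label, read off at [ord0]. *)
  rewrite (reindex_onto (fun a => [ffun=> a])
    (fun y : {ffun 'I_m.+1 -> 'I_k} => y ord0)) /=.
    apply: eq_big => [a|a _]; first by rewrite !ffunE !eqxx.
    congr (_ * _).
      rewrite (eq_bigr (fun=> p a)) => [|i _]; last by rewrite ffunE.
      by rewrite prodr_const card_ord.
    rewrite (eq_bigr (fun=> Q a a)) => [|e _]; last by rewrite !ffunE.
    by rewrite -prodr_const; apply: eq_bigl => e; rewrite inE.
  by move=> y /eqP.
have [/existsP[e /andP[eH ye]]|yc] :=
    boolP [exists e, (e \in edges H) && (y e.1 != y e.2)].
  move: eH; rewrite inE => eH.
  by rewrite (bigD1 e eH) /= Qd ?mul0r ?mulr0.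
case/negP: yN; apply/eqP/ffunP => i; rewrite ffunE.
apply: (connected_constant _ H _ y Hc) => e eH; apply/eqP.
by move: yc; rewrite negb_exists => /forallP/(_ e); rewrite eH negbK.
Qed.

Lemma star_connected t : connected_graph (star t).
Proof.
have c0 i : connect (fun u v => star t u v) ord0 i.
  have [->|iN0] := eqVneq i ord0; first exact: connect0.
  by apply: connect1; rewrite /star /= mxE eq_sym iN0.
have c1 i : connect (fun u v => star t u v) i ord0.
  have [->|iN0] := eqVneq i ord0; first exact: connect0.
  by apply: connect1; rewrite /star /= mxE iN0 orbT.
by move=> i j; apply: connect_trans (c1 i) (c0 j).
Qed.

Lemma card_edges_star2 : #|edges (star 2)| = 2%N.
Proof.
pose F i j : nat := (i, j) \in edges (star 2).
(* As a double sum of indicators the count can be evaluated by unrolling. *)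
have -> : #|edges (star 2)| = (\sum_i \sum_j F i j)%N.
  rewrite pair_bigA -sum1_card big_mkcond /=.
  by apply: eq_bigr => -[i j] _; rewrite /F; case: (_ \in _).
by rewrite !big_ord_recl !big_ord0 /F !inE /= !mxE.
Qed.

Lemma sgraph2_edge (H : sgraph 2) : has_edge H -> H = star 1.
Proof.
move=> [i [j ij]]; apply/val_inj/matrixP => a b; rewrite /= mxE.
have H01 : H ord0 (lift ord0 ord0).
  case: (unliftP ord0 i) ij => [i'|] ->; case: (unliftP ord0 j) => [j'|] ->;
  by rewrite ?ord1 ?sgraph_irr // sgraph_sym.
case: (unliftP ord0 a) => [a'|] ->; case: (unliftP ord0 b) => [b'|] ->;
by rewrite ?ord1 ?sgraph_irr ?H01 // sgraph_sym H01.
Qed.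

Lemma sum_pow_le (R : realType) k (p q : 'I_k -> R) (s : R) (m e : nat) :
  (forall a, 0 <= p a) -> (forall a, `|q a| <= 1) -> 0 <= s ->
  s ^+ 3 = \sum_a p a ^+ 3 * q a ^+ 2 -> (m.+2 <= e)%N ->
  `|\sum_a p a ^+ m.+3 * q a ^+ e| <= s ^+ m.+3.
Proof.
move=> p0 q1 s0 sE me.
have t0 a : 0 <= p a ^+ 3 * q a ^+ 2.
  by rewrite mulr_ge0 ?sqr_ge0 ?exprn_ge0.
have pq a : p a * `|q a| <= s.
  (* After cubing, [s ^+ 3] dominates its own term at [a], and [|q a| ^+ 3 <= |q a| ^+ 2]. *)
  rewrite -(@ler_pXn2r _ 3) ?nnegrE ?mulr_ge0 // sE exprMn (bigD1 a) //=.
  apply: ler_wpDr; first by apply: sumr_ge0.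
  rewrite ler_wpM2l ?exprn_ge0 // -[q a ^+ 2]real_normK ?num_real //.
  by rewrite ler_wiXn2l.
apply: le_trans (ler_norm_sum _ _ _) _.
rewrite -[m.+3]/(3 + m)%N exprD sE mulr_suml; apply: ler_sum => a _.
apply: le_trans (_ : p a ^+ 3 * q a ^+ 2 * (p a * `|q a|) ^+ m <= _); last first.
  by rewrite ler_wpM2l // lerXn2r ?nnegrE ?mulr_ge0.
(* Both sides become [p a ^+ m.+3] times a power of [|q a| <= 1], with exponents [e] and [m.+2];
   edges beyond a spanning tree only shrink the left side. *)
rewrite -[q a ^+ 2]real_normK ?num_real // normrM !normrX (ger0_norm (p0 a)).
rewrite exprMn mulrACA -!exprD ler_wpM2l ?exprn_ge0 //.
by rewrite ler_wiXn2l.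
Qed.

Lemma powR_rootK (R : realType) (x : R) (n : nat) :
  0 <= x -> (0 < n)%N -> (x `^ n%:R^-1) ^+ n = x.
Proof.
move=> x0 n0; rewrite -powR_mulrn ?powR_ge0 // -powRrM mulVf ?powRr1 //.
by rewrite pnatr_eq0 -lt0n.
Qed.

Theorem theorem3p1 (R : realType) (k : nat) (p : 'I_k -> R) (Q : 'M[R]_k)
    (hSBM : is_sbm p Q) (hdiag : is_diag_mx Q)
    (m : nat) (H : sgraph m) (hconn : connected_graph H) (hedge : has_edge H) :
  Psi p Q H <= Num.max (Psi p Q (star 1)) (Psi p Q (star 2)).
Proof.
case: m H hconn hedge => [|[|[|m]]] H hconn hedge.
(* Graphs on zero or one vertex have no edge. *)
- by case: hedge => -[].
- by case: hedge => i [j]; rewrite !ord1 sgraph_irr.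
- by rewrite (sgraph2_edge H hedge) le_max lexx.
have [p01 _ _ Q11] := hSBM.
have p0 a : 0 <= p a by case/andP: (p01 a) => /ltW.
rewrite le_max; apply/orP; right.
have s0 : 0 <= Psi p Q (star 2) by apply: powR_ge0.
rewrite -(@ler_pXn2r _ m.+3) ?nnegrE ?powR_ge0 // {1}/Psi powR_rootK //.
rewrite (Phi_diag _ _ _ _ _ H) //.
apply: sum_pow_le => //; last exact: (connected_card_edges _ H).
  by move=> a; rewrite ler_norml.
(* The absolute value in [Psi] drops because [star 2] has two edges, so every term of its sum
   contains a square. *)
rewrite /Psi powR_rootK // (Phi_diag _ _ _ _ _ (star 2)) //.
  rewrite card_edges_star2 ger0_norm // sumr_ge0 // => a _.
  by rewrite mulr_ge0 ?sqr_ge0 ?exprn_ge0.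
exact: star_connected.
Qed.
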